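(* Let $m=8+12q$ with $q=2d$ for a nonnegative integer $d$. The minimal decomposition of $\mathbb{Z}_2$ for the Fibonacci polynomial $F_m$ is $$\mathbb{Z}_2=\{0\}\sqcup\Bigl(\bigcup_{k=0}^{3}M_k\Bigr)\sqcup(2\mathbb{Z}_2-\{0\}),$$ where $M_k=\bigl(3(1+2k)+2^4\mathbb{Z}_2\bigr)\cup(7+10k+4k^2+8k^3+2^4\mathbb{Z}_2)$. Here $\{0\}$ is the set of a fixed point, the $M_k$'s are the minimal components, and the set $2\mathbb{Z}_2-\{0\}$ is the attracting basin of the fixed point $0$.
   Context: $\mathbb{Z}_2$ is the ring of 2-adic integers with the 2-adic metric. The Fibonacci polynomials are defined by $F_0(x)=0$, $F_1(x)=1$, $F_m(x)=xF_{m-1}(x)+F_{m-2}(x)$ for $m\ge 2$. For a polynomial $f$ over $\mathbb{Z}_2$, a minimal decomposition of $\mathbb{Z}_2$ for $f$ is a decomposition $\mathbb{Z}_2=\mathcal P\sqcup\mathcal M\sqcup\mathcal B$ (some parts possibly empty) in which: $\mathcal P$ is the finite set consisting of all periodic points of $f$; $\mathcal M=\bigsqcup_i\mathcal M_i$ is the union of all (at most countably many) clopen $f$-invariant sets $\mathcal M_i$ (the minimal components), each a finite union of balls, such that each $f:\mathcal M_i\to\mathcal M_i$ is minimal (every orbit is dense in $\mathcal M_i$); and each point of $\mathcal B$ lies in the attracting basin of a periodic orbit or of a minimal subsystem. A point $x$ lies in the attracting basin of a set $C$ (a periodic orbit or minimal component) if the distance from $f^n(x)$ to $C$ tends to $0$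 as $n\to\infty$; when a part $\mathcal B$ of a decomposition is said to be the attracting basin of $C$, this means every point of $\mathcal B$ lies in the attracting basin of $C$ (the points of $C$ being listed separately). *)

(* Defs.v *)
From HB Require Import structures.
From mathcomp Require Import all_boot all_order all_algebra.
From mathcomp Require Import all_classical all_reals all_analysis.

Set Implicit Arguments.
Unset Strict Implicit.
Unset Printing Implicit Defensive.

Import Order.TTheory GRing.Theory Num.Theory.
Import numFieldNormedType.Exports.

Local Open Scope classical_set_scope.
Local Open Scope ring_scope.

(* Z_2 as the inverse limit of the rings Z/2^n: [res x n] is the               *)
(* representative in [0, 2^n[ of the class of x modulo 2^n.                    *)
Record Z2 := MkZ2 {
  res : nat -> int ;
  res_coh : forall n, res n = (res n.+1 %% 2 ^+ n)%Z }.

HB.instance Definition _ := gen_eqMixin Z2.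
HB.instance Definition _ := gen_choiceMixin Z2.

Lemma Z2_eqP (x y : Z2) : (forall n, res x n = res y n) -> x = y.
Proof.
case: x y => [u hu] [v hv] /= /funext uv; subst v.
by congr MkZ2; exact: Prop_irrelevance.
Qed.

Lemma res_mod (x : Z2) n : (res x n %% 2 ^+ n)%Z = res x n.
Proof. by rewrite res_coh modz_mod. Qed.

Lemma modz_exp2S (a : int) n : ((a %% 2 ^+ n.+1)%Z %% 2 ^+ n)%Z = (a %% 2 ^+ n)%Z.
Proof.
by rewrite {2}(divz_eq a (2 ^+ n.+1)) exprS mulrA modzMDl.
Qed.

Lemma res_le (x : Z2) m n : (m <= n)%N -> res x m = (res x n %% 2 ^+ m)%Z.
Proof.
move=> /subnK <-; elim: (n - m)%N => [|k IHk]; first by rewrite add0n res_mod.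
rewrite IHk (res_coh x (k + m)) addSn exprD.
rewrite {2}(divz_eq (res x (k + m).+1) (2 ^+ k * 2 ^+ m)).
by rewrite mulrA modzMDl.
Qed.

Section OfSequence.
Variables (u : nat -> int) (hu : forall n, (u n = u n.+1 %[mod 2 ^+ n])%Z).

Lemma of_seq_subproof n :
  (u n %% 2 ^+ n)%Z = ((u n.+1 %% 2 ^+ n.+1)%Z %% 2 ^+ n)%Z.
Proof. by rewrite modz_exp2S. Qed.

Definition Z2_of_seq : Z2 := MkZ2 of_seq_subproof.
End OfSequence.

Lemma Z2_cst_subproof (a : int) n : (a = a %[mod 2 ^+ n])%Z.
Proof. by []. Qed.
Definition Z2_cst (a : int) : Z2 := Z2_of_seq (Z2_cst_subproof a).

Lemma Z2_add_subproof (x y : Z2) n :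
  (res x n + res y n = res x n.+1 + res y n.+1 %[mod 2 ^+ n])%Z.
Proof. by rewrite res_coh (res_coh y) modzDm. Qed.
Definition Z2_add (x y : Z2) : Z2 := Z2_of_seq (Z2_add_subproof x y).

Lemma Z2_opp_subproof (x : Z2) n : (- res x n = - res x n.+1 %[mod 2 ^+ n])%Z.
Proof. by rewrite res_coh modzNm. Qed.
Definition Z2_opp (x : Z2) : Z2 := Z2_of_seq (Z2_opp_subproof x).

Lemma Z2_mul_subproof (x y : Z2) n :
  (res x n * res y n = res x n.+1 * res y n.+1 %[mod 2 ^+ n])%Z.
Proof. by rewrite res_coh (res_coh y) modzMm. Qed.
Definition Z2_mul (x y : Z2) : Z2 := Z2_of_seq (Z2_mul_subproof x y).

Lemma Z2_addA : associative Z2_add.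
Proof. by move=> x y z; apply: Z2_eqP => n /=; rewrite modzDmr modzDml addrA. Qed.
Lemma Z2_addC : commutative Z2_add.
Proof. by move=> x y; apply: Z2_eqP => n /=; rewrite addrC. Qed.
Lemma Z2_add0 : left_id (Z2_cst 0) Z2_add.
Proof. by move=> x; apply: Z2_eqP => n /=; rewrite modzDml add0r res_mod. Qed.
Lemma Z2_addN : left_inverse (Z2_cst 0) Z2_opp Z2_add.
Proof. by move=> x; apply: Z2_eqP => n /=; rewrite modzDml addNr. Qed.

HB.instance Definition _ :=
  GRing.isZmodule.Build Z2 Z2_addA Z2_addC Z2_add0 Z2_addN.

Lemma Z2_mulA : associative Z2_mul.
Proof. by move=> x y z; apply: Z2_eqP => n /=; rewrite modzMmr modzMml mulrA. Qed.
Lemma Z2_mulC : commutative Z2_mul.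
Proof. by move=> x y; apply: Z2_eqP => n /=; rewrite mulrC. Qed.
Lemma Z2_mul1 : left_id (Z2_cst 1) Z2_mul.
Proof. by move=> x; apply: Z2_eqP => n /=; rewrite modzMml mul1r res_mod. Qed.
Lemma Z2_mulD : left_distributive Z2_mul Z2_add.
Proof.
by move=> x y z; apply: Z2_eqP => n /=; rewrite modzMml modzDm mulrDl.
Qed.
Lemma Z2_one_neq0 : Z2_cst 1 != Z2_cst 0.
Proof. by apply/eqP => /(congr1 (fun x => res x 1)). Qed.

HB.instance Definition _ := GRing.Zmodule_isComNzRing.Build Z2
  Z2_mulA Z2_mulC Z2_mul1 Z2_mulD Z2_one_neq0.

Lemma res0E n : res 0 n = 0.
Proof. by rewrite /= mod0z. Qed.
Lemma resDE (x y : Z2) n : res (x + y) n = ((res x n + res y n) %% 2 ^+ n)%Z.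
Proof. by []. Qed.
Lemma resNE (x : Z2) n : res (- x) n = (- res x n %% 2 ^+ n)%Z.
Proof. by []. Qed.

Lemma res_sub_eq0 (x y : Z2) n : res (x - y) n = 0 <-> res x n = res y n.
Proof.
rewrite resDE resNE modzDmr; split => [/eqP|->]; last by rewrite subrr mod0z.
rewrite -(mod0z (2 ^+ n)) -(eqz_modDr (res y n)) subrK add0r.
by rewrite !res_mod => /eqP.
Qed.

Lemma res_neq0_ex (x : Z2) : x != 0 -> exists n, res x n.+1 != 0.
Proof.
move=> x0; apply: contrapT => h; move/eqP: x0; apply; apply: Z2_eqP => -[|n].
  by rewrite res0E -res_mod expr0 modz1.
by rewrite res0E; apply: contrapT => /eqP hn; apply: h; exists n.
Qed.

(* The 2-adic valuation: the least n such that x is nonzero modulo 2^(n+1),    *)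
(* i.e. the largest n such that 2^n divides x. The value at 0 is a dummy.      *)
Definition val2 (x : Z2) : nat :=
  if pselect (exists n, res x n.+1 != 0) is left h then ex_minn h else 0%N.

Definition abs2 (R : realType) (x : Z2) : R :=
  if x == 0 then 0 else 2 ^- val2 x.

Definition dist2 (R : realType) (x y : Z2) : R := abs2 R (x - y).

Lemma val2P (x : Z2) n : x != 0 -> (n <= val2 x)%N <-> res x n = 0.
Proof.
move=> x0; rewrite /val2; case: pselect => [h|/(_ (res_neq0_ex x0))//].
case: ex_minnP => v xv vmin; split => [nv|xn0].
  case: n nv => [_|n nv]; first by rewrite -res_mod expr0 modz1.
  by apply/eqP; apply: contraTT nv => /vmin; rewrite -leqNgt.
rewrite leqNgt; apply/negP => vn; move/eqP: xv; apply.
by rewrite (res_le _ vn) xn0 mod0z.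
Qed.

Section Metric.
Variable R : realType.
Implicit Types x y z : Z2.
Local Notation dist := (dist2 R).

Lemma dist2_ge0 x y : 0 <= dist x y.
Proof. by rewrite /dist2 /abs2; case: ifP => // _; rewrite invr_ge0 exprn_ge0. Qed.

Lemma dist2_eq0 x y : dist x y = 0 -> x = y.
Proof.
rewrite /dist2 /abs2; case: ifPn => [|_ /eqP].
  by rewrite subr_eq0 => /eqP.
by rewrite invr_eq0 expf_eq0 pnatr_eq0 andbF.
Qed.

Lemma dist2xx x : dist x x = 0.
Proof. by rewrite /dist2 /abs2 subrr eqxx. Qed.

Lemma dist2_leP n x y : dist x y <= 2 ^- n <-> res x n = res y n.
Proof.
rewrite -res_sub_eq0 /dist2 /abs2; case: ifPn => [/eqP ->|h].
  by rewrite res0E; split=> // _; rewrite invr_ge0 exprn_ge0.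
by rewrite -val2P// lef_pV2 ?posrE ?exprn_gt0// ler_eXn2l ?ltr1n.
Qed.

Lemma dist2_cases x y : x = y \/ exists n, dist x y = 2 ^- n.
Proof.
rewrite /dist2 /abs2; case: ifPn => [|_]; last by right; exists (val2 (x - y)).
by rewrite subr_eq0 => /eqP; left.
Qed.

Lemma dist2_sym x y : dist x y = dist y x.
Proof.
wlog suff H : x y / dist y x <= dist x y.
  by apply/eqP; rewrite eq_le !H.
have [->|[n xy]] := dist2_cases x y; first by rewrite dist2xx.
by rewrite xy; apply/dist2_leP/esym/dist2_leP; rewrite xy.
Qed.

Lemma dist2_ultra x y z : dist x z <= Num.max (dist x y) (dist y z).
Proof.
have [->|[n xy]] := dist2_cases x y; first by rewrite le_max lexx orbT.
have [<-|[m yz]] := dist2_cases y z; first by rewrite le_max lexx.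
wlog nm : x y z n m xy yz / (n <= m)%N => [H|].
  have [/H|/ltnW mn] := leqP n m; first exact.
  rewrite maxC (dist2_sym x z) (dist2_sym x y) (dist2_sym y z).
  by apply: (H z y x m n) => //; rewrite dist2_sym.
rewrite le_max; apply/orP; left; rewrite xy; apply/dist2_leP.
transitivity (res y n); first by apply/dist2_leP; rewrite xy.
apply/dist2_leP; rewrite yz lef_pV2 ?posrE ?exprn_gt0//.
by rewrite ler_eXn2l ?ltr1n.
Qed.
End Metric.

(* The uniform structure does not depend on the field R in which distances     *)
(* are measured: its basic entourages are congruences modulo 2^n. The instance *)
(* below for each R makes it the one of the 2-adic metric.                     *)
Definition Z2_ent : set_system (Z2 * Z2) :=
  filter_from [set: nat] (fun n => [set xy | res xy.1 n = res xy.2 n]).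

Lemma Z2_ent_filter : Filter Z2_ent.
Proof.
apply: filter_from_filter; first by exists 0%N.
move=> i j _ _; exists (maxn i j) => // -[x y] /= xy.
by rewrite (res_le x (leq_maxl i j)) (res_le y (leq_maxl i j))
  (res_le x (leq_maxr i j)) (res_le y (leq_maxr i j)) xy.
Qed.

Lemma Z2_ent_diagonal A : Z2_ent A -> diagonal `<=` A.
Proof. by case=> n _ nA [x y] /= xy; apply: nA; rewrite /= (xy : x = y). Qed.

Lemma Z2_ent_inv A : Z2_ent A -> Z2_ent A^-1%relation.
Proof. by case=> n _ nA; exists n => // -[x y] /= xy; exact: nA. Qed.

Lemma Z2_ent_split A :
  Z2_ent A -> exists2 B, Z2_ent B & (B \; B `<=` A)%relation.
Proof.
case=> n _ nA; exists [set xy | res xy.1 n = res xy.2 n]; first by exists n.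
by move=> [x y] [z /= xz zy]; apply: nA; rewrite /= xz.
Qed.

HB.instance Definition _ :=
  isUniform.Build Z2 Z2_ent_filter Z2_ent_diagonal Z2_ent_inv Z2_ent_split.

Section MetricInstance.
Variable R : realType.

Definition Z2_ball (x : Z2) (e : R) : set Z2 := [set y | dist2 R x y < e].

Lemma Z2_ball_center x (e : R) : 0 < e -> Z2_ball x e x.
Proof. by move=> e0; rewrite /Z2_ball /= dist2xx. Qed.

Lemma Z2_ball_sym x y (e : R) : Z2_ball x e y -> Z2_ball y e x.
Proof. by rewrite /Z2_ball /= dist2_sym. Qed.

Lemma Z2_ball_triangle x y z (e1 e2 : R) :
  Z2_ball x e1 y -> Z2_ball y e2 z -> Z2_ball x (e1 + e2) z.
Proof.
rewrite /Z2_ball /= => xy yz; apply: le_lt_trans (dist2_ultra R x y z) _.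
rewrite gt_max (lt_le_trans xy) ?(lt_le_trans yz)//.
- by rewrite lerDr (le_trans (dist2_ge0 R x y))// ltW.
- by rewrite lerDl (le_trans (dist2_ge0 R y z))// ltW.
Qed.

Lemma Z2_entourageE : entourage = entourage_ Z2_ball.
Proof.
apply/seteqP; split=> A [].
  move=> n _ nA; exists (2 ^- n); first by rewrite /= invr_gt0 exprn_gt0.
  by move=> [x y] /= /ltW xy; apply: nA => /=; exact/(dist2_leP R).
move=> e /= e0 eA; exists (Num.truncn e^-1) => // -[x y] /= /(dist2_leP R) xy.
apply: eA; rewrite /Z2_ball /= (le_lt_trans xy)//.
rewrite invf_plt ?posrE ?exprn_gt0//.
apply: lt_le_trans (_ : (Num.truncn e^-1).+1%:R <= _).
  by rewrite truncnS_gt.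
by rewrite -natrX ler_nat ltn_expl.
Qed.

HB.instance Definition _ := Uniform_isPseudoMetric.Build R Z2
  Z2_ball_center Z2_ball_sym Z2_ball_triangle Z2_entourageE.

Lemma Z2_ballE (x : Z2) (e : R) : ball x e = [set y | dist2 R x y < e].
Proof. by []. Qed.

HB.instance Definition _ := @PseudoMetric_isMetric.Build R Z2
  (dist2 R) (dist2_ge0 R) (@dist2_eq0 R) Z2_ballE.
End MetricInstance.

Fixpoint fib_poly (A : nzRingType) (m : nat) : {poly A} :=
  match m with
  | 0%N => 0
  | 1%N => 1
  | (n.+1 as k).+1 => 'X * fib_poly A k + fib_poly A n
  end.

Section Dynamics.
Variables (R : realType) (T : metricType R) (f : T -> T).

Definition orbit_of (x : T) : set T := range (fun n => iter n f x).

Definition periodic_points : set T :=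
  [set x | exists2 n, (0 < n)%N & iter n f x = x].

Definition periodic_orbit (C : set T) : Prop :=
  exists2 x, periodic_points x & C = orbit_of x.

Definition finite_union_of_balls (C : set T) : Prop :=
  exists2 s : seq (T * R), all (fun p => 0 < p.2) s &
    C = \bigcup_(p in [set` s]) ball p.1 p.2.

Definition minimal_component (C : set T) : Prop :=
  [/\ C !=set0, clopen C, finite_union_of_balls C, f @` C `<=` C &
      forall x, C x -> C `<=` closure (orbit_of x)].

Definition in_basin (C : set T) (x : T) : Prop :=
  edist_inf C (iter n f x) @[n --> \oo] --> 0%E.
End Dynamics.

Definition minimal_decomposition (R : realType) (f : {poly Z2}) (P : set Z2)
    (I : countType) (M : I -> set Z2) (B : set Z2) : Prop :=
  let Z2R : metricType R := Z2 in
  let phi : Z2R -> Z2R := fun x => f.[x] in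
  let U := \bigcup_i M i in
  [/\ [/\ P `|` U `|` B = setT, P `&` U = set0, P `&` B = set0 & U `&` B = set0],
      finite_set P /\ P = periodic_points phi,
      trivIset setT M,
      (forall C : set Z2R, minimal_component phi C <-> exists i, M i = C) &
      forall x, B x -> exists2 C : set Z2R,
        periodic_orbit phi C \/ minimal_component phi C & in_basin phi C x].

(* a + 2^n Z_2 *)
Definition coset2 (a : Z2) (n : nat) : set Z2 := range (fun z => a + 2 ^+ n * z).

(* Main.v *)
Require Import Defs.
From mathcomp Require Import all_boot all_order all_algebra.
From mathcomp Require Import all_classical all_reals all_analysis.
From mathcomp Require Import ring zify.
Import Order.TTheory GRing.Theory Num.Theory.
Local Open Scope classical_set_scope.
Local Open Scope ring_scope.

(** Write [f] for the Fibonacci polynomial of index [m = 8 + 24 * d]. It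
    preserves parity, and the two parities are treated separately.

    On odd points everything follows from [f] modulo 32. At an odd integer the
    Fibonacci sequence has period 48 modulo 32, so only the indices 8 and 32
    have to be tabulated ([fib_tableP]). The table shows that [f] exchanges the
    two classes modulo 16 of each [M_k], that [f x = x] modulo 4 and that
    [f (f x) = x + 16] modulo 32. The congruence modulo 4 makes the derivative
    of [f] odd on odd points ([deriv_odd]) and then the derivative of the
    second iterate [g] congruent to 1 modulo 4, so that [g] transports small
    displacements unchanged to a higher order ([iter2_first_order]).
    Starting from [g x = x + 16] modulo 32, doubling the number of steps then
    gives, for the [2 ^ n]-th iterate of [g], the value [x + 2 ^ (n + 4)] modulo
    [2 ^ (n + 5)] ([iter_exp2]). Hence [g] acts on each odd class modulo 16 as
    an odometer: the orbits are dense in the class ([iter_hits]), and no odd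
    point is periodic ([iter_not_periodic]). With the exchange of the two
    classes, [f] is minimal on [M_k].

    On even points, [f x = 2 * w * x] for some [w], because [f] vanishes at 0
    and its derivative there, [m / 2], is even ([fib_even]). The [k]-th iterate is
    then divisible by [2 ^ k]: every even orbit tends to the fixed point 0,
    which is the only even periodic point.

    Finally, a minimal component is the closure of the orbit of any of its
    points. So a component with an odd point is one of the [M_k], and one with
    an even point would contain 0 and equal [{0}], which is not open. *)

Set Implicit Arguments.
Unset Strict Implicit.

(** * Congruences modulo powers of two *)

Lemma resD_congr (x x' y y' : Z2) n :
  res x n = res x' n -> res y n = res y' n -> res (x + y) n = res (x' + y') n.
Proof. by move=> hx hy; rewrite !resDE hx hy. Qed.

Lemma res_eq_le {x y : Z2} {m n : nat} :
  (m <= n)%N -> res x n = res y n -> res x m = res y m.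
Proof. by move=> mn xy; rewrite !(res_le _ mn) xy. Qed.

Lemma res_nat a n : res (a%:R : Z2) n = (a %% 2 ^ n)%N%:Z.
Proof.
have e2 : (2 ^+ n : int) = (2 ^ n)%N%:Z by rewrite -natrX natz.
rewrite -modz_nat -e2; elim: a => [|a IHa]; first by rewrite res0E mod0z.
rewrite -addn1 natrD resDE IHa PoszD modzDml.
by rewrite /= modzDmr.
Qed.

(** A class divisible by [2 ^ n] can be divided: the coherent sequence of the
    quotient is read off the residues of [x] shifted by [n]. *)
Lemma res_eq0P (x : Z2) n : res x n = 0 <-> exists z : Z2, x = 2 ^+ n * z.
Proof.
have resX k : res ((2 : Z2) ^+ n) k = (2 ^+ n %% 2 ^+ k)%Z.
  by rewrite -natrX res_nat -modz_nat -!natz !natrX.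
have resXM (z : Z2) k : res (2 ^+ n * z) k = (2 ^+ n * res z k %% 2 ^+ k)%Z.
  by rewrite -[LHS]/((res (2 ^+ n) k * res z k %% 2 ^+ k)%Z) resX modzMml.
split=> [x0|[z ->]]; last by rewrite resXM modzMr.
pose u k := (res x (n + k) %/ 2 ^+ n)%Z.
have uE k : u k * 2 ^+ n = res x (n + k).
  apply: divzK; apply/dvdz_mod0P; apply: etrans x0; symmetry.
  by apply: res_le; exact: leq_addr.
have hu k : (u k = u k.+1 %[mod 2 ^+ k])%Z.
  apply/eqP; rewrite eqz_mod_dvd -(@dvdz_mul2r (2 ^+ n)) ?expf_neq0//.
  rewrite mulrBl !uE -exprD (addnC k) -eqz_mod_dvd addnS.
  by rewrite -res_coh res_mod.
exists (Z2_of_seq hu); apply: Z2_eqP => k.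
by rewrite resXM /= modzMmr mulrC uE -res_le// leq_addl.
Qed.

(** Equality of residues is congruence modulo [2 ^ n]. The first form makes
    transitivity a rewriting step, the second one turns a congruence into a
    ring identity. *)
Lemma res_eqP (x y : Z2) n : res x n = res y n <-> exists z : Z2, x = y + 2 ^+ n * z.
Proof.
rewrite -res_sub_eq0 res_eq0P; split=> -[z e]; exists z.
  by rewrite -e addrC subrK.
by rewrite e addrAC subrr add0r.
Qed.

Lemma coset2E (a : Z2) n : coset2 a n = [set x | res x n = res a n].
Proof.
apply/seteqP; split=> x /=; first by case=> z _ <-; apply/res_eqP; exists z.
by move=> /res_eqP[z ->]; exists z.
Qed.

Lemma res1_lt2 (x : Z2) : {res x 1 = 0} + {res x 1 = 1}.
Proof.
have := res_mod x 1; rewrite expr1.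
have [->|x0] := eqVneq (res x 1) 0; first by left.
by right; lia.
Qed.

Lemma even_or_odd (x : Z2) : (exists z, x = 2 * z) \/ (exists z, x = 1 + 2 * z).
Proof.
have [x0|x1] := res1_lt2 x.
  by left; have [z] := (res_eq0P x 1).1 x0; rewrite expr1; exists z.
right; have [|z] := (res_eqP x 1 1).1; first by rewrite x1 (res_nat 1 1).
by rewrite expr1; exists z.
Qed.

Lemma res_even (z : Z2) : res (2 * z) 1 = 0.
Proof. by apply/res_eq0P; exists z. Qed.

Lemma res_odd (z : Z2) : res (1 + 2 * z) 1 = 1.
Proof. by rewrite -[RHS]/(res (1 : Z2) 1); apply/res_eqP; exists z. Qed.

(** * First-order expansions of polynomials *)

Lemma horner_first_order {A : comNzRingType} (p : {poly A}) (x h : A) :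
  exists r, p.[x + h] = p.[x] + h * p^`().[x] + h ^+ 2 * r.
Proof.
elim/poly_ind: p => [|p c [r IHr]].
  by exists 0; rewrite deriv0 !horner0; ring.
exists (p^`().[x] + r * (x + h)).
rewrite derivD derivM derivX derivC addr0 mulr1 !hornerE IHr; ring.
Qed.

Lemma horner_sub_dvd {A : comNzRingType} (p : {poly A}) (x h : A) :
  exists r, p.[x + h] = p.[x] + h * r.
Proof.
have [r ->] := horner_first_order p x h; exists (p^`().[x] + h * r); ring.
Qed.

(** The first-order expansion with step 2 reads the parity of the derivative
    off the values of [p] modulo 4: if [p] is the identity modulo 4 at [x] and
    at [x + 2], an even derivative would force 2 to be 0 modulo 4. *)
Lemma deriv_not_even {A : comNzRingType} (p : {poly A}) (x a b w : A) :
    p.[x] = x + 4 * a -> p.[x + 2] = x + 2 + 4 * b -> p^`().[x] = 2 * w ->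
  exists c, 2 = 4 * c :> A.
Proof.
move=> aE bE wE; have [r] := horner_first_order p x 2.
rewrite aE bE wE => e; exists (a + w + r - b).
have -> : (2 : A) = x + 2 + 4 * b - (x + 4 * b) by ring.
by rewrite e; ring.
Qed.

(** By the chain rule the derivative of [p \o p] at [x] is
    [p^`().[x] * p^`().[p.[x]]]. Since [p.[x]] is [x] modulo 4, this is the
    square of an odd number modulo 4, that is, 1; and the quadratic terms
    carry a second factor [2 ^ n.+2]. So [p \o p] moves a displacement by
    [2 ^ n.+2 * t] along unchanged modulo [2 ^ n.+4]. *)
Lemma iter2_first_order {A : comNzRingType} (p : {poly A}) (x s w t : A) n :
    p.[x] = x + 4 * s -> p^`().[x] = 1 + 2 * w ->
  exists r, p.[p.[x + 2 ^+ n.+2 * t]] =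
    p.[p.[x]] + 2 ^+ n.+2 * t + 2 ^+ n.+4 * r.
Proof.
move=> sE wE; set h := 2 ^+ n.+2 * t.
have [r rE] := horner_first_order p x h.
have [v vE] := horner_sub_dvd p^`() x (4 * s).
have [u uE] := horner_first_order p p.[x] (h * (1 + 2 * w + h * r)).
have -> : p.[x + h] = p.[x] + h * (1 + 2 * w + h * r) by rewrite rE wE; ring.
rewrite uE [X in p^`().[X]]sE vE wE.
(* [w + w ^+ 2] comes from [(1 + 2 * w) ^+ 2 = 1 + 4 * (w + w ^+ 2)] *)
exists (t * (w + w ^+ 2 + (1 + 2 * w) * s * v +
  2 ^+ n * t * r * (1 + 2 * w + 4 * s * v) +
  2 ^+ n * t * (1 + 2 * w + h * r) ^+ 2 * u)).
by rewrite /h !exprS; ring.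
Qed.

Lemma horner_congr (p : {poly Z2}) (x y : Z2) n :
  res x n = res y n -> res p.[x] n = res p.[y] n.
Proof.
move=> /res_eqP[z ->]; apply/res_eqP.
have [r ->] := horner_sub_dvd p y (2 ^+ n * z).
by exists (z * r); rewrite mulrA.
Qed.

(** * Polynomials acting as an odometer on odd points *)

Section OddPart.
Variable p : {poly Z2}.
Hypothesis p_mod4 : forall x, res x 1 = 1 -> res p.[x] 2 = res x 2.

Lemma p_odd x : res x 1 = 1 -> res p.[x] 1 = 1.
Proof. by move=> x1; rewrite (res_eq_le _ (p_mod4 x1)). Qed.

Lemma mod4P x : res x 1 = 1 -> exists s : Z2, p.[x] = x + 4 * s.
Proof.
move=> /p_mod4/res_eqP[s ->]; exists s; congr (_ + _ * _); ring.
Qed.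

Lemma deriv_odd x : res x 1 = 1 -> exists w : Z2, p^`().[x] = 1 + 2 * w.
Proof.
move=> x1; have [[w wE]|//] := even_or_odd p^`().[x].
have x21 : res (x + 2) 1 = 1.
  rewrite -x1; apply/res_eqP; exists 1; ring.
have [a aE] := mod4P x1; have [b bE] := mod4P x21.
have [c cE] : exists c : Z2, (2 : Z2) = 4 * c := deriv_not_even aE bE wE.
suff /eqP : res (2 : Z2) 2 = 0 by rewrite (res_nat 2 2).
by apply/res_eq0P; exists c; rewrite [LHS]cE; congr (_ * _); ring.
Qed.

Lemma iter2_lipschitz (x t : Z2) n : res x 1 = 1 ->
  res p.[p.[x + 2 ^+ n.+2 * t]] n.+4 = res (p.[p.[x]] + 2 ^+ n.+2 * t) n.+4.
Proof.
move=> x1; have [w wE] := deriv_odd x1; have [s sE] := mod4P x1.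
by apply/res_eqP; exact: iter2_first_order sE wE.
Qed.

Hypothesis p_mod32 : forall x, res x 1 = 1 -> res p.[p.[x]] 5 = res (x + 16) 5.

Let g (x : Z2) : Z2 := p.[p.[x]].

Lemma iter_odd k x : res x 1 = 1 -> res (iter k g x) 1 = 1.
Proof. by move=> x1; elim: k => //= k IHk; rewrite /g !p_odd. Qed.

Lemma iter_lipschitz k x t n : res x 1 = 1 ->
  res (iter k g (x + 2 ^+ n.+2 * t)) n.+4 = res (iter k g x + 2 ^+ n.+2 * t) n.+4.
Proof.
move=> x1; elim: k => [//|k /res_eqP[s IHk]].
rewrite !iterS IHk.
have -> : iter k g x + 2 ^+ n.+2 * t + 2 ^+ n.+4 * s =
  iter k g x + 2 ^+ n.+2 * (t + 4 * s) by rewrite !exprS; ring.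
rewrite /g iter2_lipschitz ?iter_odd// -/g; apply/res_eqP; exists s.
by rewrite /g !exprS; ring.
Qed.

(** The displacement doubles with the number of iterations: if [G] is the
    [2 ^ n]-th iterate and [G x = x + h], where [h] is an odd multiple of
    [2 ^ (n + 4)], then [G (x + h)] is [G x + h = x + 2 * h] modulo
    [2 ^ (n + 6)]. *)
Lemma iter_exp2 n x : res x 1 = 1 ->
  res (iter (2 ^ n) g x) (n + 5) = res (x + 2 ^+ (n + 4)) (n + 5).
Proof.
elim: n x => [|n IHn] x x1.
  by rewrite expn0 !add0n p_mod32//; congr res; congr (_ + _); ring.
rewrite expnS mul2n -addnn iterD.
have [s sE] := (res_eqP _ _ _).1 (IHn _ x1).
have yE : iter (2 ^ n) g x = x + 2 ^+ (n + 2).+2 * (1 + 2 * s).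
  by rewrite sE !addnS !addn0 !exprS; ring.
have [r rE] := (res_eqP _ _ _).1 (iter_lipschitz (2 ^ n) (1 + 2 * s) (n + 2) x1).
rewrite yE rE yE; apply/res_eqP; exists (s + r).
by rewrite !addnS !addn0 !exprS; ring.
Qed.

Lemma iter_exp2_mul n r x : res x 1 = 1 ->
  res (iter (2 ^ n * r) g x) (n + 5) = res (x + 2 ^+ (n + 4) * r%:R) (n + 5).
Proof.
move=> x1; elim: r => [|r IHr]; first by rewrite muln0 mulr0 addr0.
rewrite mulnSr addnC iterD iter_exp2 ?iter_odd//.
rewrite (resD_congr IHr (erefl (res (2 ^+ (n + 4)) _))) -addn1 natrD.
congr res; ring.
Qed.

(** At level [n] the orbit of [x] turns like an odometer: it comes back to its
    class modulo [2 ^ (n + 4)] only after multiples of [2 ^ n] steps. *)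
Lemma iter_return n k x : res x 1 = 1 ->
  res (iter k g x) (n + 4) = res x (n + 4) -> (2 ^ n %| k)%N.
Proof.
move=> x1; elim: n k => [|n IHn] k; first by rewrite expn0 dvd1n.
rewrite addSnnS => kx; have /IHn : res (iter k g x) (n + 4) = res x (n + 4).
  by apply: res_eq_le kx; rewrite leq_add2l.
case/dvdnP => r kE; move: kx; rewrite kE mulnC.
rewrite (iter_exp2_mul n r x1).
move=> e; have {e} := (res_sub_eq0 _ _ _).2 e.
rewrite (addrC x) addrK -natrX -natrM res_nat => -[/eqP].
rewrite (addnS n 4) expnSr -/(dvdn _ _) dvdn_pmul2l ?expn_gt0//.
by move=> r2; rewrite expnSr dvdn_pmul2l ?expn_gt0.
Qed.

(** A return after [k] steps would be a return at every level, and already at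
    level [k] this needs [2 ^ k] to divide [k]. *)
Lemma iter_not_periodic k x : res x 1 = 1 -> (0 < k)%N -> iter k g x <> x.
Proof.
move=> x1 k0 kx; have := @iter_return k k x x1; rewrite kx => /(_ erefl).
by move/dvdn_leq => /(_ k0); rewrite leqNgt ltn_expl.
Qed.

(** Minimality in residues: once the class of [y] modulo [2 ^ (n + 4)] is
    reached, [2 ^ n] further steps switch between its two halves, one of which
    is the class modulo [2 ^ (n + 5)]. *)
Lemma iter_hits x y n : res x 1 = 1 -> res y 4 = res x 4 ->
  exists k, res (iter k g x) (n + 4) = res y (n + 4).
Proof.
move=> x1 yx; elim: n => [|n [k /esym/res_eqP[z yE]]]; first by exists 0%N.
have [[t tE]|[t tE]] := even_or_odd z; rewrite tE in yE.
  exists k; apply/esym/res_eqP; exists t.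
  by rewrite yE !addnS !addn0 !exprS; ring.
exists (2 ^ n + k)%N; rewrite addSnnS iterD iter_exp2 ?iter_odd//.
apply/esym/res_eqP; exists t; rewrite yE !addnS !addn0 !exprS; ring.
Qed.
End OddPart.

(** * The topology of the 2-adic integers through residues *)

Section Topology.
Variable R : realType.
Local Notation T := (Z2 : metricType R).

Lemma nbhs_resP (x : T) (A : set T) :
  nbhs x A <-> exists n, forall y, res y n = res x n -> A y.
Proof.
rewrite -nbhs_entourageE; split.
  move=> [E [n _ nE] EA]; exists n => y yx; apply: EA; rewrite /xsection /= inE.
  by apply: nE => /=.
move=> [n nA]; exists [set xy : Z2 * Z2 | res xy.1 n = res xy.2 n].
  by exists n.
by move=> y; rewrite /xsection /= inE /= => /esym/nA.
Qed.

Lemma closure_resP (A : set T) (y : T) :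
  closure A y <-> forall n, exists2 x, A x & res x n = res y n.
Proof.
split=> [Ay n|h B /nbhs_resP[n nB]].
  have [|x [Ax xy]] := Ay [set x | res x n = res y n]; last by exists x.
  by apply/nbhs_resP; exists n.
by have [x Ax xy] := h n; exists x; split=> //; exact: nB.
Qed.

Lemma clopen_coset2 (a : Z2) n : clopen (coset2 a n : set T).
Proof.
rewrite coset2E; split.
  rewrite openE => x /= xa; apply/nbhs_resP; exists n => y yx.
  by rewrite /= yx.
by move=> x /closure_resP/(_ n)[y /= <- ->].
Qed.

(** The nonzero values of the metric are powers of 2, so that the open ball of
    radius [2 ^- n] is the closed ball of radius [2 ^- n.+1]. *)
Lemma coset2_ball (a : Z2) n : (coset2 a n.+1 : set T) = ball (a : T) (2 ^- n : R).
Proof.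
rewrite coset2E Z2_ballE; apply/seteqP; split=> x /=.
  move=> /esym/(dist2_leP R) h; apply: le_lt_trans h _.
  by rewrite ltf_pV2 ?posrE ?exprn_gt0// exprS ltr_pMl ?exprn_gt0// ltr1n.
have [->//|[k kE]] := dist2_cases R a x.
rewrite kE ltf_pV2 ?posrE ?exprn_gt0// ltr_eXn2l ?ltr1n// => nk.
by apply: (res_eq_le nk); apply/esym/(dist2_leP R); rewrite kE.
Qed.

(** The extended distance to a set is continuous, so that convergence of the
    orbit to [a] suffices; the latter is stabilization of residues. *)
Lemma in_basin_fixed (f : T -> T) (a x : T) :
  (forall n, exists N, forall k, (N <= k)%N -> res (iter k f x) n = res a n) ->
  in_basin f [set a] x.
Proof.
move=> h; rewrite /in_basin.
have <- : @edist_inf R T [set a] a = 0%E by apply: edist_inf0.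
apply: (@cvg_comp _ _ _ (fun n => iter n f x) (@edist_inf R T [set a]) _ (nbhs a));
  last exact: edist_inf_continuous.
move=> A /nbhs_resP[n nA]; have [N hN] := h n.
by exists N => // k /= /hN/nA.
Qed.

End Topology.

(** * Periodic points, basins and minimal components *)

Lemma iter_double (T : Type) (f : T -> T) n x :
  iter n (fun y => f (f y)) x = iter (n * 2) f x.
Proof. by elim: n => //= n ->. Qed.

Lemma iter_fixed_mul (T : Type) (f : T -> T) n k x :
  iter n f x = x -> iter (k * n) f x = x.
Proof. by move=> fx; elim: k => //= k IHk; rewrite mulSn iterD IHk. Qed.

Section MinimalComponents.
Variables (R : realType) (p : {poly Z2}).
Hypothesis p_mod4 : forall x, res x 1 = 1 -> res p.[x] 2 = res x 2.
Hypothesis p_mod32 : forall x, res x 1 = 1 -> res p.[p.[x]] 5 = res (x + 16) 5.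
Local Notation T := (Z2 : metricType R).
Let phi : T -> T := fun x => p.[x] : Z2.

Lemma odd_not_periodic (x : Z2) : res x 1 = 1 -> ~ periodic_points phi x.
Proof.
move=> x1 [n n0 nx].
apply: (iter_not_periodic p_mod4 p_mod32 x1 n0).
by rewrite (iter_double phi) mulnC; exact: iter_fixed_mul.
Qed.

(** The second iterate reaches everything in the class of its starting point
    modulo 16; the other class is reached by starting one step later. *)
Lemma coset2_pair_dense (a b x y : Z2) : res a 1 = 1 ->
    res p.[a] 4 = res b 4 -> res x 4 = res a 4 ->
  (coset2 a 4 `|` coset2 b 4) y -> closure (orbit_of phi x : set T) y.
Proof.
rewrite !coset2E => a1 ab xa yC; apply/closure_resP => n.
have x1 : res x 1 = 1 by rewrite -a1; exact: res_eq_le xa.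
suff [k kE] : exists k, res (iter k phi x) (n + 4) = res y (n + 4).
  by exists (iter k phi x); [exists k|apply: res_eq_le kE; exact: leq_addr].
case: yC => /= [ya|yb].
  have [|k] := @iter_hits _ p_mod4 p_mod32 x y n x1; first by rewrite ya xa.
  by rewrite (iter_double phi) => kE; exists (k * 2)%N.
have [||k] := @iter_hits _ p_mod4 p_mod32 p.[x] y n.
- exact: p_odd.
- by rewrite yb (horner_congr p xa) ab.
by rewrite (iter_double phi) -[p.[x]]/(phi x) -iterSr => kE; exists (k * 2).+1.
Qed.

Lemma coset2_pair_minimal (a b : Z2) : res a 1 = 1 ->
    res p.[a] 4 = res b 4 -> res p.[b] 4 = res a 4 ->
  minimal_component phi (coset2 a 4 `|` coset2 b 4).
Proof.
move=> a1 ab ba.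
have b1 : res b 1 = 1 by rewrite -(@res_eq_le _ _ 1 4 _ ab)// p_odd.
split.
- by exists a; left; rewrite coset2E.
- have [oa ca] := clopen_coset2 R a 4; have [ob cb] := clopen_coset2 R b 4.
  by split; [exact: openU|exact: closedU].
- exists [:: (a : T, 2 ^- 3 : R); (b : T, 2 ^- 3 : R)].
    by rewrite /= !invr_gt0 !exprn_gt0.
  rewrite !(coset2_ball R); apply/seteqP; split=> x.
    case=> xB; first by exists (a : T, 2 ^- 3 : R); rewrite //= !inE eqxx.
    by exists (b : T, 2 ^- 3 : R); rewrite //= !inE eqxx orbT.
  by case=> q; rewrite /= !inE => /orP[] /eqP -> xB; [left|right].
- rewrite !coset2E => _ [x [] /= xE <-]; [right|left].
    by rewrite /= (horner_congr p xE).
  by rewrite /= (horner_congr p xE).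
- move=> x xC y yC; rewrite !coset2E in xC; case: xC => /= xE.
    exact: coset2_pair_dense xE yC.
  by rewrite setUC in yC; exact: coset2_pair_dense xE yC.
Qed.

Hypothesis p_even : forall z : Z2, exists w : Z2, p.[2 * z] = 2 * w * (2 * z).

Lemma iter_even k (z : Z2) : exists w : Z2, iter k phi (2 * z) = 2 ^+ k * w * (2 * z).
Proof.
elim: k => [|k [w IHk]]; first by exists 1; rewrite /=; ring.
have [v vE] := p_even (2 ^+ k * w * z).
exists (v * w); rewrite iterS IHk.
have -> : 2 ^+ k * w * (2 * z) = 2 * (2 ^+ k * w * z) by ring.
by rewrite [LHS]vE exprS; ring.
Qed.

Lemma horner0_even : p.[0] = 0.
Proof. by have [w] := p_even 0; rewrite !mulr0. Qed.

(** Going round the cycle [k] times shows that [2 ^ k] divides the point. *)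
Lemma even_periodic (z : Z2) : periodic_points phi (2 * z) -> 2 * z = 0.
Proof.
case=> n n0 nz; apply: Z2_eqP => k; rewrite res0E; apply/res_eq0P.
have [w wE] := iter_even (k * n) z; rewrite iter_fixed_mul// in wE.
exists (2 ^+ (k * n - k) * w * (2 * z)).
by rewrite !mulrA -exprD subnKC ?leq_pmulr// -!mulrA mulrA.
Qed.

Lemma even_in_basin (z : Z2) : in_basin phi [set 0] (2 * z : T).
Proof.
apply: in_basin_fixed => n; exists n => k nk; rewrite res0E; apply/res_eq0P.
have [w ->] := iter_even k z; exists (2 ^+ (k - n) * w * (2 * z)).
by rewrite -{1}(subnKC nk) exprD !mulrA.
Qed.

Lemma iter0_even k : iter k phi 0 = 0.
Proof. by elim: k => // k IHk; rewrite iterS IHk; exact: horner0_even. Qed.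

Lemma orbit0_even : orbit_of phi 0 = [set 0].
Proof.
apply/seteqP; split=> [_ [k _ <-]|_ ->]; first exact: iter0_even.
by exists 0%N.
Qed.

(** Two components with a common point are therefore equal, and the component
    of a point is determined by its orbit. *)
Lemma minimal_component_closed_orbit (C : set T) (x : T) :
  minimal_component phi C -> C x -> C = closure (orbit_of phi x).
Proof.
case=> _ [_ clC] _ invC dC Cx; apply/seteqP; split; first exact: dC.
rewrite [X in _ `<=` X](closure_id _).1//; apply: closure_subset.
move=> _ [k _ <-]; elim: k => // k IHk; apply: invC; exact: imageP.
Qed.

(** A component containing an even point would contain its limit 0, hence, being
    open, a neighbourhood of 0; but the orbit of 0 is dense only in [{0}]. *)
Lemma even_no_component (C : set T) (z : Z2) :
  minimal_component phi C -> ~ C (2 * z).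
Proof.
move=> mC Cz; have C0 : C 0.
  rewrite (minimal_component_closed_orbit mC Cz); apply/closure_resP => n.
  have [w wE] := iter_even n z; exists (iter n phi (2 * z)); first by exists n.
  by rewrite res0E wE; apply/res_eq0P; exists (w * (2 * z)); ring.
have CE := minimal_component_closed_orbit mC C0.
have [_ [oC _] _ _ _] := mC.
have [n nC] := (nbhs_resP (0 : T) C).1 (open_nbhs_nbhs (conj oC C0)).
have : C (2 ^+ n).
  by apply: nC; rewrite res0E; apply/res_eq0P; exists 1; rewrite mulr1.
rewrite CE orbit0_even => /closure_resP/(_ n.+1)[_ ->].
by rewrite res0E -natrX res_nat modn_small ?ltn_exp2l// => /eqP;
  rewrite eq_sym eqz_nat expn_eq0.
Qed.

End MinimalComponents.

(** * Fibonacci polynomials on even points and modulo 32 *)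

Lemma fib_polySS (A : comNzRingType) n (x : A) :
  (fib_poly A n.+2).[x] = x * (fib_poly A n.+1).[x] + (fib_poly A n).[x].
Proof. by rewrite -[fib_poly A n.+2]/('X * fib_poly A n.+1 + fib_poly A n) !hornerE. Qed.

(** On even points only the expansion at 0 up to order two matters; here [j]
    is the derivative at 0 of the polynomial of index [2 * j]. *)
Lemma fib_poly_near0 (A : comNzRingType) j (x : A) :
  (exists u, (fib_poly A (2 * j)).[x] = x * (j%:R + x * u)) /\
  (exists v, (fib_poly A (2 * j).+1).[x] = 1 + x * v).
Proof.
elim: j => [|j [[u uE] [v vE]]].
  by rewrite muln0 /= !hornerE; split; exists 0; ring.
have e : (fib_poly A (2 * j).+2).[x] = x * (j.+1%:R + x * (v + u)).
  by rewrite fib_polySS uE vE -addn1 natrD; ring.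
rewrite mulnS add2n; split; first by exists (v + u).
by rewrite fib_polySS e vE; exists (v + x * (j.+1%:R + x * (v + u))); ring.
Qed.

Definition fib_step32 (a : nat) (s : nat * nat) : nat * nat :=
  (s.2, (a * s.2 + s.1) %% 32)%N.

Local Notation fib_mod32 a n := (iter n (fib_step32 a) (0, 1)%N).

Lemma fib_poly_mod32 (x : Z2) a n : res x 5 = a%:Z ->
  res (fib_poly Z2 n).[x] 5 = (fib_mod32 a n).1%:Z.
Proof.
move=> xa; suff [] : res (fib_poly Z2 n).[x] 5 = (fib_mod32 a n).1%:Z /\
  res (fib_poly Z2 n.+1).[x] 5 = (fib_mod32 a n).2%:Z by [].
elim: n => [|n [IH1 IH2]].
  by rewrite /= horner0 hornerC res0E (res_nat 1 5).
split=> //; rewrite fib_polySS resDE IH1 -[res (_ * _) 5]/((_ * _ %% _)%Z).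
by rewrite xa IH2 modzDml /= -modz_nat PoszD PoszM.
Qed.

Definition odd_mod32 := [seq a <- iota 0 32 | odd a].

(** Modulo 32 the Fibonacci sequence at an odd point has period 48, while
    [m = 8 + 24 * d] with [d] arbitrary: two values of [m] remain. *)
Lemma fib_mod32_odd a d : a \in odd_mod32 ->
  (fib_mod32 a (8 + 24 * d)).1 = (fib_mod32 a (if odd d then 32 else 8)).1.
Proof.
move=> ha; have per e : fib_mod32 a (48 * e) = (0, 1)%N.
  elim: e => // e IHe; rewrite mulnS iterD IHe.
  have /allP per48 : all (fun a => fib_mod32 a 48 == (0, 1)%N) odd_mod32.
    by vm_compute.
  by apply/eqP; apply: per48.
have -> : (8 + 24 * d = (if odd d then 32 else 8) + 48 * d./2)%N.
  by rewrite -{1}(odd_double_half d); case: (odd d); lia.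
by rewrite iterD per.
Qed.

(** The two classes modulo 16 that make up the [k]-th component. *)
Definition comp_a k := (3 * (1 + 2 * k))%N.
Definition comp_b k := (7 + 10 * k + 4 * k ^ 2 + 8 * k ^ 3)%N.

(** All that is needed of the map induced modulo 32 on odd classes. The
    conditions that [f a] is odd and less than 32 keep [f a] in the table, so
    that [f (f a)] is again determined by the values of [f] on it. *)
Definition fib_table (f : nat -> nat) :=
  all (fun a => [&& f (f a) == (a + 16) %% 32, f a == a %[mod 4], odd (f a), f a < 32 &
    all (fun k => ((a == comp_a k %[mod 16]) ==> (f a == comp_b k %[mod 16])) &&
      ((a == comp_b k %[mod 16]) ==> (f a == comp_a k %[mod 16]))) (iota 0 4)])%N
    odd_mod32.

Lemma fib_table_ext (f h : nat -> nat) :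
  {in odd_mod32, f =1 h} -> fib_table f -> fib_table h.
Proof.
rewrite /fib_table => fh /allP tf; apply/allP => a ha; have := tf a ha.
have /and5P[_ _ o lt _] := tf a ha.
have fa : f a \in odd_mod32 by rewrite mem_filter o mem_iota.
by rewrite -(fh a ha) -(fh _ fa).
Qed.

Lemma fib_tableP d : fib_table (fun a => (fib_mod32 a (8 + 24 * d)).1).
Proof.
apply: (@fib_table_ext (fun a => (fib_mod32 a (if odd d then 32 else 8)).1)).
  by move=> a ha; symmetry; exact: fib_mod32_odd.
by case: (odd d); vm_compute.
Qed.

Lemma res_natP (x : Z2) n : exists2 a, (a < 2 ^ n)%N & res x n = a%:Z.
Proof.
have e2 : (2 ^+ n : int) = (2 ^ n)%N%:Z by rewrite -natrX natz.
have x0 : 0 <= res x n by rewrite -res_mod modz_ge0// expf_neq0.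
exists (absz (res x n)); last by rewrite gez0_abs.
by rewrite -ltz_nat gez0_abs// -e2 -res_mod ltz_pmod// exprn_gt0.
Qed.

Lemma res_nat_small (x : Z2) m n a : (m <= n)%N -> res x n = a%:Z ->
  res x m = (a %% 2 ^ m)%N%:Z.
Proof.
move=> mn xa; rewrite (res_le x mn) xa -modz_nat.
by congr (_ %% _)%Z; rewrite -natz natrX.
Qed.

Section Fib.
Variable d : nat.
Let F := fib_poly Z2 (8 + 24 * d).

Lemma fib_odd_cases (x : Z2) : res x 1 = 1 -> exists a b : nat,
  [/\ res x 5 = a%:Z, res F.[x] 5 = b%:Z, res F.[F.[x]] 5 = ((a + 16) %% 32)%N%:Z,
      b = a %[mod 4] &
      forall k, (k < 4)%N ->
       (a = comp_a k %[mod 16] -> b = comp_b k %[mod 16]) /\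
       (a = comp_b k %[mod 16] -> b = comp_a k %[mod 16])]%N.
Proof.
move=> x1; have [a a32 xa] := res_natP x 5.
have := fib_tableP d; rewrite /fib_table => /allP tF.
have ha : a \in odd_mod32.
  rewrite mem_filter mem_iota a32 andbT.
  by move: x1; rewrite (@res_nat_small x 1 5 a)// modn2; case: (odd a).
exists a, (iter (8 + 24 * d) (fib_step32 a) (0, 1)%N).1.
have /and5P[/eqP h16 /eqP h4 _ _ /allP hk] := tF a ha.
have xb := fib_poly_mod32 (8 + 24 * d) xa.
split=> //; first by rewrite -h16; exact: fib_poly_mod32.
move=> k k4; have kI : k \in iota 0 4 by rewrite mem_iota.
have /andP[/implyP ab /implyP ba] := hk k kI.
by split=> /eqP => [/ab|/ba] /eqP.
Qed.

Lemma fib_mod4 (x : Z2) : res x 1 = 1 -> res F.[x] 2 = res x 2.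
Proof.
move=> /fib_odd_cases[a [b [xa xb _ ab _]]].
by rewrite (res_nat_small (m := 2) _ xa)// (res_nat_small _ xb)// ab.
Qed.

Lemma fib_mod32_shift (x : Z2) : res x 1 = 1 -> res F.[F.[x]] 5 = res (x + 16) 5.
Proof.
move=> /fib_odd_cases[a [b [xa _ -> _ _]]].
by rewrite resDE xa (res_nat 16 5) -modz_nat PoszD.
Qed.

Lemma fib_swap (x : Z2) k : res x 1 = 1 -> (k < 4)%N ->
  (res x 4 = res (comp_a k)%:R 4 -> res F.[x] 4 = res (comp_b k)%:R 4) /\
  (res x 4 = res (comp_b k)%:R 4 -> res F.[x] 4 = res (comp_a k)%:R 4).
Proof.
move=> /fib_odd_cases[a [b [xa xb _ _ h]]] /h[ab ba].
rewrite !res_nat (res_nat_small (m := 4) _ xa)// (res_nat_small _ xb)//.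
by split=> -[e]; [rewrite ab|rewrite ba].
Qed.

Lemma fib_even (z : Z2) : exists w : Z2, F.[2 * z] = 2 * w * (2 * z).
Proof.
have [[u uE] _] := fib_poly_near0 (4 + 12 * d) (2 * z).
exists (2 + 6 * d%:R + z * u).
have e : (8 + 24 * d = 2 * (4 + 12 * d))%N by lia.
rewrite /F e; apply: etrans uE _.
by rewrite natrD natrM; ring.
Qed.
End Fib.

Lemma comp_aE k : 3 * (1 + 2 * k%:R) = (comp_a k)%:R :> Z2.
Proof. by rewrite /comp_a !(natrM, natrD). Qed.

Lemma comp_bE k :
  7 + 10 * k%:R + 4 * k%:R ^+ 2 + 8 * k%:R ^+ 3 = (comp_b k)%:R :> Z2.
Proof. by rewrite /comp_b !(natrD, natrM, natrX). Qed.

Lemma comp_odd k : odd (comp_a k) /\ odd (comp_b k).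
Proof. by rewrite /comp_a /comp_b !(oddD, oddM, oddX). Qed.

Lemma comp_cover a : (a < 16)%N -> odd a -> exists2 k, (k < 4)%N &
  (a == comp_a k %[mod 16])%N || (a == comp_b k %[mod 16])%N.
Proof.
move=> a16 oa.
have /allP/(_ a) : all (fun a => odd a ==> has (fun k =>
  (a == comp_a k %[mod 16]) || (a == comp_b k %[mod 16]))%N (iota 0 4)) (iota 0 16).
  by vm_compute.
rewrite mem_iota a16 oa => /(_ isT)/hasP[k]; rewrite mem_iota => k4 h.
by exists k.
Qed.

Lemma comp_disjoint a k l : (k < 4)%N -> (l < 4)%N ->
  (a == comp_a k %[mod 16])%N || (a == comp_b k %[mod 16])%N ->
  (a == comp_a l %[mod 16])%N || (a == comp_b l %[mod 16])%N -> k = l.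
Proof.
move=> k4 l4.
case: k k4 => [|[|[|[|//]]]] _; case: l l4 => [|[|[|[|//]]]] _ //; rewrite /comp_a /comp_b; lia.
Qed.

Lemma res1_nat_odd a : odd a -> res (a%:R : Z2) 1 = 1.
Proof. by rewrite res_nat modn2 => ->. Qed.

Lemma comp_pairE k :
  coset2 (comp_a k)%:R 4 `|` coset2 (comp_b k)%:R 4 =
  [set x : Z2 | res x 4 = (comp_a k %% 16)%N%:Z \/ res x 4 = (comp_b k %% 16)%N%:Z].
Proof. by rewrite !coset2E !res_nat. Qed.

Lemma comp_pairP (x : Z2) a k : res x 4 = (a %% 16)%N%:Z ->
  (coset2 (comp_a k)%:R 4 `|` coset2 (comp_b k)%:R 4) x <->
  (a == comp_a k %[mod 16])%N || (a == comp_b k %[mod 16])%N.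
Proof.
rewrite comp_pairE /mkset => ->; split=> [[[e]|[e]]|/orP[] /eqP ->].
- by rewrite e eqxx.
- by rewrite e eqxx orbT.
- by left.
- by right.
Qed.

Lemma res4_nat (x : Z2) : exists2 a, (a < 16)%N & res x 4 = (a %% 16)%N%:Z.
Proof. by have [a a16 xa] := res_natP x 4; exists a; rewrite ?modn_small. Qed.

Lemma comp_cover_res (x : Z2) : res x 1 = 1 -> exists2 k, (k < 4)%N &
  (coset2 (comp_a k)%:R 4 `|` coset2 (comp_b k)%:R 4) x.
Proof.
move=> x1; have [a a16 xa] := res4_nat x.
have oa : odd a.
  by move: x1; rewrite (res_nat_small _ xa)// (modn_small a16) modn2; case: (odd a).
by have [k k4 h] := comp_cover a16 oa; exists k => //; apply/(comp_pairP k xa).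
Qed.

Lemma comp_odd_res (x : Z2) k :
  (coset2 (comp_a k)%:R 4 `|` coset2 (comp_b k)%:R 4) x -> res x 1 = 1.
Proof.
have [oa ob] := comp_odd k.
by rewrite !coset2E => -[]; rewrite /mkset => h;
  rewrite (@res_eq_le _ _ 1 4 _ h)// res1_nat_odd.
Qed.

Lemma comp_disjoint_res (x : Z2) k l : (k < 4)%N -> (l < 4)%N ->
  (coset2 (comp_a k)%:R 4 `|` coset2 (comp_b k)%:R 4) x ->
  (coset2 (comp_a l)%:R 4 `|` coset2 (comp_b l)%:R 4) x -> k = l.
Proof.
move=> k4 l4; have [a _ xa] := res4_nat x.
by move=> /(comp_pairP k xa) hk /(comp_pairP l xa); exact: comp_disjoint.
Qed.

(** * The minimal decomposition *)

Theorem theorem8p3 (R : realType) (m q d : nat)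
    (hq : q = (2 * d)%N) (hm : m = (8 + 12 * q)%N) :
  let F : {poly Z2} := fib_poly Z2 m in
  let f : (Z2 : metricType R) -> (Z2 : metricType R) := fun x => F.[x] in
  let M : 'I_4 -> set Z2 := fun k =>
    coset2 (3 * (1 + 2 * k%:R)) 4 `|`
    coset2 (7 + 10 * k%:R + 4 * k%:R ^+ 2 + 8 * k%:R ^+ 3) 4 in
  let B : set Z2 := [set 2 * z | z in [set: Z2]] `\ 0 in
  [/\ minimal_decomposition R F [set 0] M B,
      f 0 = 0 &
      forall x, B x -> in_basin f [set 0] x].
Proof.
have {q hq hm} -> : m = (8 + 24 * d)%N by lia.
move=> F f M B.
have p4 := @fib_mod4 d; have p32 := @fib_mod32_shift d; have pe := @fib_even d.
have ME (k : 'I_4) :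
    M k = coset2 (comp_a k)%:R 4 `|` coset2 (comp_b k)%:R 4.
  by rewrite /M comp_aE comp_bE.
have Modd k x : M k x -> res x 1 = 1 by rewrite ME => /comp_odd_res.
have Mcover x : res x 1 = 1 -> exists k, M k x.
  by move=> /comp_cover_res[k k4 xk]; exists (Ordinal k4); rewrite ME.
have Mmin k : minimal_component f (M k).
  rewrite ME; have [oa ob] := comp_odd k.
  apply: coset2_pair_minimal => //; first exact: res1_nat_odd.
    exact: (fib_swap d (res1_nat_odd oa) (ltn_ord k)).1.
  exact: (fib_swap d (res1_nat_odd ob) (ltn_ord k)).2.
have f0 : f 0 = 0 by exact: horner0_even pe.
have P0 : periodic_points f 0 by exists 1%N.
have even_not_odd z : res (2 * z) 1 <> 1 by rewrite res_even.
have Bbasin x : B x -> in_basin f [set 0] x.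
  by move=> [[z _ <-] _]; exact: (@even_in_basin R _ pe z).
split=> //; split.
- split; apply/seteqP; split=> x //.
  + move=> _; have [[z xz]|[z xz]] := even_or_odd x.
      have [x0|/eqP x0] := eqVneq x 0; first by left; left.
      by right; split=> //; exists z.
    by have [|k xk] := Mcover x; [rewrite xz res_odd|left; right; exists k].
  + by move=> [-> [k _ /Modd]]; rewrite res0E.
  + by move=> [-> [_]]; apply.
  + by move=> [[k _ /Modd x1] [[z _ zx] _]]; case: (even_not_odd z); rewrite zx.
- split; first exact: finite_set1.
  apply/seteqP; split=> x; first by move=> ->.
  have [[z ->]|[z xz]] := even_or_odd x; first exact: even_periodic.
  apply: contraPP => _; apply: odd_not_periodic => //.
  by rewrite xz res_odd.
- move=> k l _ _ [x [xk xl]]; apply: ord_inj; rewrite !ME in xk xl.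
  exact: comp_disjoint_res xk xl.
- move=> C; split=> [mC|[k <-]//].
  have [[x Cx] _ _ _ _] := mC.
  have [[z xz]|[z xz]] := even_or_odd x.
    by case: (even_no_component pe (z := z) mC); rewrite -xz.
  have [|k xk] := Mcover x; first by rewrite xz res_odd.
  exists k; rewrite (minimal_component_closed_orbit mC Cx).
  exact: minimal_component_closed_orbit (Mmin k) xk.
- move=> x Bx; exists [set 0]; last exact: Bbasin.
  by left; exists 0 => //; rewrite (orbit0_even _ pe).
Qed.
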